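(* Let $((A,\mu),(M,l,r),T)$ be a relative Rota-Baxter algebra over a field $\mathbb K$ of characteristic $0$, and let an infinitesimal deformation of it be determined by the quadruple $(\mu_1,l_1,r_1,T_1)$, with $\mu_1\in\mathrm{Hom}(A\otimes A,A)$, $l_1\in\mathrm{Hom}(A\otimes M,M)$, $r_1\in\mathrm{Hom}(M\otimes A,M)$, $T_1\in\mathrm{Hom}(M,A)$. Then the quadruple, regarded as the element $(\mu_1+l_1+r_1,T_1)\in C^2(A,M,T)$, is a $2$-cocycle in the cochain complex $(C^\bullet(A,M,T),\mathcal D)$ defining the cohomology of the relative Rota-Baxter algebra. Conversely, any infinitesimal deformation is obtained by a $2$-cocycle in this way.
   Context: Relative Rota-Baxter algebra: an associative algebra $(A,\mu)$, an $A$-bimodule $(M,l,r)$ (left action $l$, right action $r$) and a linear map $T:M\to A$ with $T(m)T(n)=T(T(m)n+mT(n))$. The same notion makes sense over a commutative ring $\mathsf R$ (with $\mathsf R$-modules and $\mathsf R$-linear maps). Infinitesimal deformation: let $\mathsf R=\mathbb K[[t]]/(t^2)$ with augmentation $\epsilon:\mathsf R\to\mathbb K$, $\epsilon(f)=f(0)$. It is an $\mathsf R$-relative Rota-Baxter algebra $((\mathsf R\otimes_{\mathbb K}A,\mu_{\mathsf R}),(\mathsf R\otimes_{\mathbb K}M,l_{\mathsf R},r_{\mathsf R}),T_{\mathsf R})$ such that $(\epsilon\otimes\mathrm{id}_A,\epsilon\otimes\mathrm{id}_M)$ is a morphism of $\mathsf R$-relative Rota-Baxter algebras to $((A,\mu),(M,l,r),T)$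 (with $\mathsf R$ acting on $A$, $M$ through $\epsilon$); a morphism $(\varphi,\psi)$ consists of an algebra homomorphism $\varphi$ and a linear map $\psi$ compatible with the actions and with $T'\psi=\varphi T$. This forces $\mu_{\mathsf R}=\mu+t\mu_1$, $l_{\mathsf R}=l+tl_1$, $r_{\mathsf R}=r+tr_1$, $T_{\mathsf R}=T+tT_1$ (extended $\mathsf R$-linearly), and the deformation is said to be determined by $(\mu_1,l_1,r_1,T_1)$. Cochain complex: let $\pi=\mu+l+r$ on $V=A\oplus M$ (maps extended by zero). Gerstenhaber bracket: for $f\in\mathrm{Hom}(V^{\otimes m+1},V)$, $g\in\mathrm{Hom}(V^{\otimes n+1},V)$, $(f\diamond g)(v_1,\ldots,v_{m+n+1})=\sum_{i=1}^{m+1}(-1)^{(i-1)n}f(v_1,\ldots,v_{i-1},g(v_i,\ldots,v_{i+n}),\ldots,v_{m+n+1})$, $[f,g]=f\diamond g-(-1)^{mn}g\diamond f$. Let $\mathcal A^{n-1,1}$ be the direct sum of all tensor products of $n-1$ copies of $A$ and one of $M$ in any order. Then $C^0(A,M,T)=0$, $C^1(A,M,T)=\mathrm{Hom}(A,A)\oplus\mathrm{Hom}(M,M)$, and for $n\ge2$, $C^n(A,M,T)=\mathrm{Hom}(A^{\otimes n},A)\oplus\mathrm{Hom}(\mathcal A^{n-1,1},M)\oplus\mathrm{Hom}(M^{\otimes n-1},A)$. For $f\in\mathrm{Hom}(A^{\otimes n},A)\oplus\mathrm{Hom}(\mathcal A^{n-1,1},M)$ and $P\in\mathrm{Hom}(M^{\otimes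 n-1},A)$ ($P$ absent if $n=1$), $\mathcal D(f,P)=\big((-1)^{n-1}[\pi,f],\,(-1)^n[[\pi,T],P]+\Omega f\big)$, where $(\Omega f)(u_1,\ldots,u_n)=(-1)^n\big(f(Tu_1,\ldots,Tu_n)-\sum_{i=1}^nT f(Tu_1,\ldots,u_i,\ldots,Tu_n)\big)$ for $u_j\in M$ (with $u_i$ in the $i$-th slot not hit by $T$). One has $\mathcal D^2=0$. *)

(* Defs.v *)
From HB Require Import structures.
From mathcomp Require Import all_boot all_algebra.

Set Implicit Arguments.
Unset Strict Implicit.
Unset Printing Implicit Defensive.

Import GRing.Theory Pdiv.CommonRing Pdiv.RingMonic.
Local Open Scope ring_scope.

(* Algebras are associative but not assumed unital. *)
Record relRB (R : comNzRingType) (A M : lmodType R) := RelRB {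
  rb_mul : {bilinear A -> A -> A};
  rb_l : {bilinear A -> M -> M};
  rb_r : {bilinear M -> A -> M};
  rb_T : {linear M -> A};
  rb_mulA : associative rb_mul;
  rb_lA : forall a b m, rb_l (rb_mul a b) m = rb_l a (rb_l b m);
  rb_rA : forall m a b, rb_r m (rb_mul a b) = rb_r (rb_r m a) b;
  rb_lr : forall a m b, rb_r (rb_l a m) b = rb_l a (rb_r m b);
  rb_TE : forall m n,
    rb_mul (rb_T m) (rb_T n) = rb_T (rb_l (rb_T m) n + rb_r m (rb_T n))
}.

(* The S-modules A' and M' are regarded as R-modules through nu : R -> S, so  *)
(* that R-linear maps into them are nu-semilinear maps.                       *)
Record relRB_morphism (R S : comNzRingType) (nu : {rmorphism R -> S})
    (A M : lmodType R) (A' M' : lmodType S)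
    (D : relRB A M) (D' : relRB A' M') (phi : A -> A') (psi : M -> M') : Prop :=
  RelRBMorphism {
  rbm_phi_linear : linear_for (nu \; *:%R) phi;
  rbm_psi_linear : linear_for (nu \; *:%R) psi;
  rbm_mul : forall a b, phi (rb_mul D a b) = rb_mul D' (phi a) (phi b);
  rbm_l : forall a m, psi (rb_l D a m) = rb_l D' (phi a) (psi m);
  rbm_r : forall m a, psi (rb_r D m a) = rb_r D' (psi m) (phi a);
  rbm_T : forall m, rb_T D' (psi m) = phi (rb_T D m)
}.

(* K[[t]]/(t^2) = K[t]/(t^2); see trunc_ps below. *)
Notation dualnum K := {poly %/ ('X^2 : {poly K})}.

Section DualNumbers.
Variable K : fieldType.
Local Notation R := (dualnum K).
Implicit Types (p q : R) (f g : nat -> K).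

Definition dual_t : R := in_qpoly 'X^2 'X.
Definition aug (p : R) : K := p`_0.

Lemma mk_monicX2 : mk_monic ('X^2 : {poly K}) = 'X^2.
Proof. by rewrite mk_monic_Xn. Qed.

Lemma dualP p q : p`_0 = q`_0 -> p`_1 = q`_1 -> p = q.
Proof.
move=> e0 e1; apply/npolyP => -[|[|i]] //.
by rewrite !big_coef_npoly // mk_monicX2 size_polyXn.
Qed.

Lemma coef_in_dual (P : {poly K}) i :
  (i < 2)%N -> (in_qpoly 'X^2 P : R)`_i = P`_i.
Proof.
move=> i2; rewrite /= mk_monicX2.
rewrite [in RHS](rdivp_eq (monicXn K 2) P).
by rewrite coefD coefMXn i2 add0r.
Qed.

Lemma dual_mul0 p q : (p * q)`_0 = p`_0 * q`_0.
Proof. by rewrite coef_in_dual // coefM big_ord1. Qed.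

Lemma dual_mul1 p q : (p * q)`_1 = p`_0 * q`_1 + p`_1 * q`_0.
Proof. by rewrite coef_in_dual // coefM big_ord_recl big_ord1. Qed.

Lemma dual_one0 : (1 : R)`_0 = 1. Proof. by rewrite /= coefC. Qed.
Lemma dual_one1 : (1 : R)`_1 = 0. Proof. by rewrite /= coefC. Qed.
Lemma dual_t0 : dual_t`_0 = 0. Proof. by rewrite coef_in_dual // coefX. Qed.
Lemma dual_t1 : dual_t`_1 = 1. Proof. by rewrite coef_in_dual // coefX. Qed.

Fact aug_zmod_morphism : zmod_morphism aug.
Proof. by move=> p q; rewrite /aug /= coefB. Qed.
Fact aug_monoid_morphism : monoid_morphism aug.
Proof. by split=> [|p q]; rewrite /aug ?dual_one0 ?dual_mul0. Qed.
HB.instance Definition _ := GRing.isZmodMorphism.Build R K aug aug_zmod_morphism.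
HB.instance Definition _ :=
  GRing.isMonoidMorphism.Build R K aug aug_monoid_morphism.

(* A formal power series over K is the sequence of its coefficients; the      *)
(* Cauchy product is their multiplication. The lemmas below say that trunc_ps *)
(* is a surjective ring morphism K[[t]] -> K[t]/(t^2) with kernel (t^2).      *)
Definition ps_mul f g n : K := \sum_(i < n.+1) f i * g (n - i)%N.
Definition trunc_ps f : R := in_qpoly 'X^2 (\poly_(i < 2) f i).

Lemma trunc_ps_coef f i : (i < 2)%N -> (trunc_ps f)`_i = f i.
Proof. by move=> i2; rewrite coef_in_dual // coef_poly i2. Qed.

Lemma trunc_psD f g : trunc_ps (fun n => f n + g n) = trunc_ps f + trunc_ps g.
Proof. by apply: dualP; rewrite [RHS]coefD !trunc_ps_coef. Qed.

Lemma trunc_ps1 : trunc_ps (fun n => (n == 0)%:R) = 1.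
Proof. by apply: dualP; rewrite trunc_ps_coef // ?dual_one0 ?dual_one1. Qed.

Lemma trunc_psM f g : trunc_ps (ps_mul f g) = trunc_ps f * trunc_ps g.
Proof.
apply: dualP; rewrite ?dual_mul0 ?dual_mul1 !trunc_ps_coef //.
  by rewrite /ps_mul big_ord1.
by rewrite /ps_mul big_ord_recl big_ord1.
Qed.

Lemma trunc_ps_surj p : exists f, trunc_ps f = p.
Proof. by exists (fun n => p`_n); apply: dualP; rewrite trunc_ps_coef. Qed.

Lemma trunc_ps_ker f :
  trunc_ps f = 0 <-> exists g, f =1 ps_mul (fun n => (n == 2)%:R) g.
Proof.
split=> [f0|[g fE]].
  exists (fun n => f n.+2) => -[|[|n]].
  - by rewrite -(trunc_ps_coef f (isT : 0 < 2)%N) f0 /ps_mul big_ord1 coef0 mul0r.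
  - rewrite -(trunc_ps_coef f (isT : 1 < 2)%N) f0 /ps_mul big_ord_recl big_ord1.
    by rewrite coef0 !mul0r addr0.
  rewrite /ps_mul (bigD1 (inord 2 : 'I_n.+3)) //= big1 ?addr0.
    by rewrite inordK // eqxx mul1r subSS subSS subn0.
  move=> i; rewrite -val_eqE /= inordK // => /negPf ->.
  by rewrite mul0r.
apply: dualP; rewrite trunc_ps_coef // coef0 fE /ps_mul.
  by rewrite big_ord1 mul0r.
by rewrite big_ord_recl big_ord1 !mul0r addr0.
Qed.

End DualNumbers.

(* R (x)_K W for R = K[t]/(t^2): the pair (x, y) stands for 1 (x) x + t (x) y. *)
Definition ext (K : fieldType) (W : lmodType K) : Type := (W * W)%type.

Section Ext.
Variables (K : fieldType) (W : lmodType K).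
Local Notation R := (dualnum K).
Implicit Types (p q : R) (x y : ext W).

HB.instance Definition _ := GRing.Zmodule.copy (ext W) (W * W)%type.

Definition ext_scale p x : ext W := (p`_0 *: x.1, p`_0 *: x.2 + p`_1 *: x.1).

Fact ext_scaleA p q x : ext_scale p (ext_scale q x) = ext_scale (p * q) x.
Proof.
rewrite /ext_scale /= dual_mul0 dual_mul1 !scalerDr !scalerDl !scalerA.
by rewrite addrA.
Qed.
Fact ext_scale1 : left_id 1 ext_scale.
Proof.
by case=> x y; rewrite /ext_scale dual_one0 dual_one1 !scale1r scale0r addr0.
Qed.
Fact ext_scaleDr : right_distributive ext_scale +%R.
Proof.
move=> p x y; congr pair; first by rewrite scalerDr.
by rewrite !scalerDr addrACA.
Qed.
Fact ext_scaleDl x : {morph ext_scale^~ x : p q / p + q}.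
Proof.
move=> p q; rewrite /ext_scale [(p + q)`_0]coefD [(p + q)`_1]coefD.
by congr pair; rewrite !scalerDl // addrACA.
Qed.
HB.instance Definition _ := GRing.Zmodule_isLmodule.Build R (ext W)
  ext_scaleA ext_scale1 ext_scaleDr ext_scaleDl.

Definition tens p (w : W) : ext W := (p`_0 *: w, p`_1 *: w).

(* aug (x) id_W, as W = K (x)_K W *)
Definition aug_tens (x : ext W) : W := x.1.

Lemma aug_tensE p w : aug_tens (tens p w) = aug p *: w. Proof. by []. Qed.

Lemma tensZ p q w : q *: tens p w = tens (q * p) w.
Proof.
congr pair; rewrite ?dual_mul0 ?dual_mul1 /=; first by rewrite scalerA.
by rewrite !scalerA -scalerDl.
Qed.

Fact tens_bilinear :
  bilinear_for (GRing.Scale.Law.clone _ _ *:%R _)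
    (GRing.Scale.Law.clone _ _ *:%R _) (tens : R -> W -> W * W).
Proof.
split=> [w a p q|p a w w']; congr pair; rewrite /= ?coefD ?coefZ.
- by rewrite scalerDl scalerA.
- by rewrite scalerDl scalerA.
- by rewrite scalerDr !scalerA mulrC.
- by rewrite scalerDr !scalerA mulrC.
Qed.

(* The universal property of the tensor product over K. *)
Lemma tens_universal (X : lmodType K) (b : {bilinear R -> W -> X}) :
  exists2 g : {linear (W * W)%type -> X}, (forall p w, g (tens p w) = b p w) &
    forall g' : {linear (W * W)%type -> X},
      (forall p w, g' (tens p w) = b p w) -> g' =1 g.
Proof.
pose g0 (x : W * W) : X := b 1 x.1 + b (dual_t K) x.2.
have g0_lin : linear g0.
  move=> a x y; rewrite /g0 /= !linearPr scalerDr.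
  by rewrite addrACA.
pose g : {linear (W * W)%type -> X} :=
  HB.pack g0 (GRing.isLinear.Build K (W * W)%type X *:%R g0 g0_lin).
have gE p w : g (tens p w) = b p w.
  rewrite /= /g0 /= !linearZr_LR /= -!linearZl_LR -linearDl; congr (b _ w).
  by apply: dualP; rewrite [LHS]coefD !coefZ ?dual_one0 ?dual_one1 ?dual_t0
    ?dual_t1 ?(mulr0, mulr1, addr0, add0r).
exists g => // g' g'E x.
have -> : x = tens 1 x.1 + tens (dual_t K) x.2 :> W * W.
  rewrite /tens dual_one0 dual_one1 dual_t0 dual_t1 !scale0r !scale1r.
  by case: x => x y; congr pair; rewrite /= ?addr0 ?add0r.
by rewrite !raddfD /= -/(g' _) !g'E; congr (_ + _); rewrite -gE.
Qed.

End Ext.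

Section Deformation.
Variables (K : fieldType) (A M : lmodType K) (D : relRB A M).
Local Notation t := (dual_t K).

Record quadruple := Quadruple {
  q_mul : {bilinear A -> A -> A};
  q_l : {bilinear A -> M -> M};
  q_r : {bilinear M -> A -> M};
  q_T : {linear M -> A}
}.

Definition infinitesimal_deformation (E : relRB (ext A) (ext M)) : Prop :=
  relRB_morphism (@aug K) E D (@aug_tens K A) (@aug_tens K M).

(* The structure maps of E are R-linear, hence fixed by these values. *)
Record determined_by (E : relRB (ext A) (ext M)) (q : quadruple) : Prop :=
  DeterminedBy {
  det_mul : forall a b : A, rb_mul E (tens 1 a) (tens 1 b) =
    tens 1 (rb_mul D a b) + tens t (q_mul q a b);
  det_l : forall (a : A) (m : M), rb_l E (tens 1 a) (tens 1 m) =
    tens 1 (rb_l D a m) + tens t (q_l q a m);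
  det_r : forall (m : M) (a : A), rb_r E (tens 1 m) (tens 1 a) =
    tens 1 (rb_r D m a) + tens t (q_r q m a);
  det_T : forall m : M, rb_T E (tens 1 m) =
    tens 1 (rb_T D m) + tens t (q_T q m)
}.

End Deformation.

Section Gerstenhaber.
Variables (K : fieldType) (V : lmodType K).

(* Maps of Gerstenhaber degree d, i.e. of d.+1 arguments. *)
Definition mmap d := {ffun 'I_d.+1 -> V} -> V.

Definition multilinear d (f : mmap d) := forall (i : 'I_d.+1) v c x y,
  let upd z := [ffun j => if j == i then z else v j] in
  f (upd (c *: x + y)) = c *: f (upd x) + f (upd y).

(* The index i is 0-based, whence the sign (-1)^(i * n). *)
Definition diamond m n (f : mmap m) (g : mmap n) : mmap (m + n) := fun v =>
  \sum_(i < m.+1) (-1) ^+ (i * n) *: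
    f [ffun j : 'I_m.+1 =>
         if (j < i)%N then v (inord j)
         else if j == i then g [ffun k : 'I_n.+1 => v (inord (i + k))]
         else v (inord (j + n))].

(* 'inord' only transports along (n + m)%N = (m + n)%N *)
Definition bracket m n (f : mmap m) (g : mmap n) : mmap (m + n) := fun v =>
  diamond f g v - (-1) ^+ (m * n) *: diamond g f [ffun i : 'I_(n + m).+1 => v (inord i)].

End Gerstenhaber.

Section Complex.
Variables (K : fieldType) (A M : lmodType K).
Local Notation V := (A * M)%type.

Definition homogeneous d (S : {set 'I_d.+1}) (v : {ffun 'I_d.+1 -> V}) :=
  forall j, if j \in S then (v j).1 = 0 else (v j).2 = 0.

(* Hom(A^{(x) n}, A) (+) Hom(A^{n-1,1}, M) for n = d.+1, extended by zero *)
Definition in_HomA d (f : mmap V d) :=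
  multilinear f /\
  forall (S : {set 'I_d.+1}) v, homogeneous S v ->
    match #|S| with
    | 0 => (f v).2 = 0
    | 1 => (f v).1 = 0
    | _ => f v = 0
    end.

(* Hom(M^{(x) n}, A) for n = d.+1, extended by zero *)
Definition in_HomM d (P : mmap V d) :=
  multilinear P /\
  forall (S : {set 'I_d.+1}) v, homogeneous S v ->
    if S == setT then (P v).2 = 0 else P v = 0.

Definition cochain n : Type :=
  match n with
  | 0 => unit
  | 1 => mmap V 0
  | d.+2 => (mmap V d.+1 * mmap V d)%type
  end.

Definition in_C n : cochain n -> Prop :=
  match n with
  | 0 => fun _ => True
  | 1 => fun f => in_HomA f
  | d.+2 => fun c => in_HomA c.1 /\ in_HomM c.2
  end.

Definition zero_cochain n : cochain n -> Prop :=
  match n with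
  | 0 => fun _ => True
  | 1 => fun f => forall v, f v = 0
  | d.+2 => fun c => (forall v, c.1 v = 0) /\ (forall v, c.2 v = 0)
  end.

Definition lift2 (mu : A -> A -> A) (l : A -> M -> M) (r : M -> A -> M) :
    mmap V 1 := fun v =>
  let x := v ord0 in let y := v ord_max in
  (mu x.1 y.1, l x.1 y.2 + r x.2 y.1).

Definition lift1 (T : M -> A) : mmap V 0 := fun v => (T (v ord0).2, 0).

Variable D : relRB A M.

Definition pi_map : mmap V 1 := lift2 (rb_mul D) (rb_l D) (rb_r D).
Definition T_map : mmap V 0 := lift1 (rb_T D).

Definition Omega d (f : mmap V d) : mmap V d := fun v =>
  let T (x : V) : V := (rb_T D x.2, 0) in
  (-1) ^+ d.+1 *:
    (f [ffun j => T (v j)]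
     - \sum_(i < d.+1)
         T (f [ffun j => if j == i then (0, (v j).2) else T (v j)])).

(* The f-component has d.+2 arguments in C^(d.+2), whence its sign            *)
(* (-1)^(d.+1), and the sign (-1)^d = (-1)^(d.+2) of the P-component.          *)
Definition differential n : cochain n -> cochain n.+1 :=
  match n with
  | 0 => fun _ _ => 0
  | 1 => fun f => (bracket pi_map f, Omega f)
  | d.+2 => fun c =>
      ((fun v => (-1) ^+ d.+1 *: bracket pi_map c.1 v),
       (fun v => (-1) ^+ d.+2 *: bracket (bracket pi_map T_map) c.2 v
                 + Omega c.1 v))
  end.

Definition cocycle n (c : cochain n) : Prop :=
  in_C c /\ zero_cochain (differential c).

Definition quadruple_cochain (q : quadruple A M) : cochain 2 :=
  (lift2 (q_mul q) (q_l q) (q_r q), lift1 (q_T q)).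

End Complex.

(* Main.v *)
Require Import Defs.
From HB Require Import structures.
From mathcomp Require Import all_boot all_algebra.

(** An R-linear or R-bilinear map between modules of the form R (x) W is fixed
    by its values f + t f1 on the elements 1 (x) w. The structure maps of an
    infinitesimal deformation are therefore the extensions of mu + t mu1,
    l + t l1, r + t r1 and T + t T1, and since t^2 = 0 each axiom of a relative
    Rota-Baxter algebra splits into the axiom for D (coefficient of 1) and its
    linearization (coefficient of t). Evaluating D(mu1 + l1 + r1, T1) on the
    homogeneous parts of A (+) M gives exactly these linearizations: the four
    associativity axioms in the first component and the Rota-Baxter identity
    in the second. *)

Set Implicit Arguments.
Unset Strict Implicit.
Unset Printing Implicit Defensive.

Import GRing.Theory.
Local Open Scope ring_scope.

(** * Linear and bilinear maps over the dual numbers *)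

Section DualExtension.
Variable K : fieldType.
Local Notation t := (dual_t K).

Lemma ext_eq (W : lmodType K) (x y : ext W) : x.1 = y.1 -> x.2 = y.2 -> x = y.
Proof. by case: x y => [x1 x2] [y1 y2] /= -> ->. Qed.

Lemma ext_fstZ (W : lmodType K) p (x : ext W) : (p *: x).1 = p`_0 *: x.1.
Proof. by []. Qed.

Lemma ext_sndZ (W : lmodType K) p (x : ext W) :
  (p *: x).2 = p`_0 *: x.2 + p`_1 *: x.1.
Proof. by []. Qed.

Lemma ext_fstD (W : lmodType K) (x y : ext W) : (x + y).1 = x.1 + y.1.
Proof. by []. Qed.

Lemma ext_sndD (W : lmodType K) (x y : ext W) : (x + y).2 = x.2 + y.2.
Proof. by []. Qed.

Definition extE := (ext_fstZ, ext_sndZ, ext_fstD, ext_sndD).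

Lemma ext_tZ (W : lmodType K) (x : ext W) : t *: x = (0, x.1).
Proof.
by apply: ext_eq; rewrite !extE dual_t0 ?dual_t1 /= !scale0r ?scale1r ?add0r.
Qed.

Lemma tens_1 (W : lmodType K) (w : W) : tens 1 w = (w, 0).
Proof. by rewrite /tens dual_one0 dual_one1 scale1r scale0r. Qed.

Lemma tens1_t (W : lmodType K) (w w' : W) : tens 1 w + tens t w' = (w, w').
Proof.
by apply: ext_eq; rewrite extE tens_1 /= ?dual_t0 ?dual_t1 ?scale0r ?scale1r
  ?addr0 ?add0r.
Qed.

Lemma ext_decomp (W : lmodType K) (x : ext W) :
  x = tens 1 x.1 + t *: tens 1 x.2.
Proof. by apply: ext_eq; rewrite extE ext_tZ !tens_1 /= ?addr0 ?add0r. Qed.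

(** Views the scalar [c] as a constant polynomial in [R], the form in which an [R]-linear map can
    absorb it. *)
Lemma tens1P (W : lmodType K) c (w w' : W) :
  tens 1 (c *: w + w') = in_qpoly 'X^2 c%:P *: tens 1 w + tens 1 w'.
Proof.
rewrite !tens_1; apply: ext_eq; rewrite !extE !coef_in_dual // !coefC //=.
by rewrite scaler0 scale0r !addr0.
Qed.

(* The R-linear extension of f + t f1. *)
Definition ext_lin (U W : lmodType K) (f f1 : U -> W) (x : ext U) : ext W :=
  (f x.1, f x.2 + f1 x.1).

(** The bilinear analogue: products of two [t]-components carry [t^2] and drop out, as does [f1] on
    any [t]-component. *)
Definition ext_bil (U V W : lmodType K) (f f1 : U -> V -> W)
    (x : ext U) (y : ext V) : ext W :=
  (f x.1 y.1, f x.1 y.2 + f x.2 y.1 + f1 x.1 y.1).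

Section Linear.
Variables (U W : lmodType K).

Section Build.
Variables f f1 : {linear U -> W}.

Fact ext_lin_linear : linear (ext_lin f f1 : ext U -> ext W).
Proof.
move=> p x y; apply: ext_eq; rewrite !extE /= !(linearD, linearZ) //=.
by rewrite (AC (3*2) ((1*4*2)*(3*5))).
Qed.

Definition ext_linear : {linear ext U -> ext W} :=
  HB.pack (ext_lin f f1 : ext U -> ext W)
    (GRing.isLinear.Build _ _ _ _ (ext_lin f f1 : ext U -> ext W)
       ext_lin_linear).

End Build.

Lemma ext_linP (F : {linear ext U -> ext W}) (f f1 : U -> W) :
  (forall u, F (tens 1 u) = (f u, f1 u)) -> F =1 ext_lin f f1.
Proof.
move=> FE x; rewrite [x in LHS]ext_decomp linearD linearZ /= !FE ext_tZ /=.
by apply: ext_eq; rewrite extE /= ?addr0 // addrC.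
Qed.

Fact ext_snd_linear (F : {linear ext U -> ext W}) :
  linear (fun u => (F (tens 1 u)).2).
Proof.
move=> c x y; rewrite tens1P linearD linearZ !extE !coef_in_dual // !coefC /=.
by rewrite scale0r addr0.
Qed.

(** Applied to [rb_T E], this extracts [T1] from a given deformation; [ext_snd_bil] does the same
    for the three products. *)
Definition ext_snd_lin (F : {linear ext U -> ext W}) : {linear U -> W} :=
  HB.pack (fun u => (F (tens 1 u)).2)
    (GRing.isLinear.Build _ _ _ _ (fun u => (F (tens 1 u)).2)
       (ext_snd_linear F)).

End Linear.

Section Bilinear.
Variables (U V W : lmodType K).

Section Build.
Variables f f1 : {bilinear U -> V -> W}.

Fact ext_bil_bilinear :
  bilinear_for *:%R *:%R (ext_bil f f1 : ext U -> ext V -> ext W).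
Proof.
split=> [z|z] p x y; apply: ext_eq; rewrite !extE /=;
  rewrite ?(linearDl, linearDr, linearZl_LR, linearZr_LR) ?scalerDr //=.
- by rewrite (AC (2*3*2) ((1*3*6*4)*(2*5*7))).
- by rewrite (AC (3*2*2) ((1*4*6*2)*(3*5*7))).
Qed.

Definition ext_bilinear : {bilinear ext U -> ext V -> ext W} :=
  HB.pack (ext_bil f f1 : ext U -> ext V -> ext W)
    (bilinear_isBilinear.Build _ _ _ _ _ _
       (ext_bil f f1 : ext U -> ext V -> ext W) ext_bil_bilinear).

End Build.

(** Expanding both arguments by [ext_decomp] gives four terms, and the one carrying [t *: (t *: _)]
    vanishes by [ext_tZ]. *)
Lemma ext_bilP (F : {bilinear ext U -> ext V -> ext W}) (f f1 : U -> V -> W) :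
    (forall u v, F (tens 1 u) (tens 1 v) = (f u v, f1 u v)) ->
  F =2 ext_bil f f1.
Proof.
move=> FE x y; rewrite [x in LHS]ext_decomp [y in LHS]ext_decomp.
rewrite linearDl !linearDr !linearZl_LR !linearZr_LR !FE !ext_tZ /=.
by apply: ext_eq; rewrite !extE /= ?addr0 // -addrA addrC.
Qed.

Fact ext_snd_bilinear (F : {bilinear ext U -> ext V -> ext W}) :
  bilinear_for *:%R *:%R (fun u v => (F (tens 1 u) (tens 1 v)).2).
Proof.
split=> [z|z] c x y /=; rewrite tens1P ?(linearDl, linearDr) /=
  ?(linearZl_LR, linearZr_LR) !extE !coef_in_dual // !coefC /=;
  by rewrite scale0r addr0.
Qed.

Definition ext_snd_bil (F : {bilinear ext U -> ext V -> ext W}) :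
    {bilinear U -> V -> W} :=
  HB.pack (fun u v => (F (tens 1 u) (tens 1 v)).2)
    (bilinear_isBilinear.Build _ _ _ _ _ _
       (fun u v => (F (tens 1 u) (tens 1 v)).2) (ext_snd_bilinear F)).

End Bilinear.

(* Covers associativity of mu and the three bimodule axioms. *)
Lemma ext_bilA (U V X Y Z W : lmodType K)
    (f f1 : {bilinear X -> Z -> W}) (g g1 : {bilinear U -> V -> X})
    (h h1 : {bilinear U -> Y -> W}) (k k1 : {bilinear V -> Z -> Y}) :
    (forall u v z, f (g u v) z = h u (k v z)) ->
  (forall x y z, ext_bil f f1 (ext_bil g g1 x y) z =
                 ext_bil h h1 x (ext_bil k k1 y z)) <->
  (forall u v z, f1 (g u v) z + f (g1 u v) z =
                 h1 u (k v z) + h u (k1 v z)).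
Proof.
move=> fgA; split=> [E u v z|E x y z].
  (* Arguments without [t]-part leave only the linearization in the coefficient of [t]. *)
  move/(congr1 snd): (E (u, 0) (v, 0) (z, 0)) => /=.
  by rewrite !(linear0l, linear0r, addr0, add0r) addrC => ->; rewrite addrC.
(* In the coefficient of [t], the terms in [x.2], [y.2] or [z.2] match by [fgA]; the rest is [E] at
   the first components. *)
apply: ext_eq; rewrite /= ?fgA // !(linearDl, linearDr) /= !fgA.
rewrite (AC (1*3*1) (1*2*3*(5*4))) /= E.
by rewrite (AC (3*2) (1*2*5*3*4)).
Qed.

(** Same splitting as for associativity: terms with [x.2] or [y.2] match by the Rota-Baxter identity
    of [T], leaving the linearized identity at [x.1], [y.1]. *)
Lemma ext_RB (A M : lmodType K) (mu mu1 : {bilinear A -> A -> A})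
    (l l1 : {bilinear A -> M -> M}) (r r1 : {bilinear M -> A -> M})
    (T T1 : {linear M -> A}) :
    (forall m n, mu (T m) (T n) = T (l (T m) n + r m (T n))) ->
  (forall x y, ext_bil mu mu1 (ext_lin T T1 x) (ext_lin T T1 y) =
     ext_lin T T1 (ext_bil l l1 (ext_lin T T1 x) y
                   + ext_bil r r1 x (ext_lin T T1 y) : ext M)) <->
  (forall m n, mu (T1 m) (T n) + mu (T m) (T1 n) + mu1 (T m) (T n) =
     T1 (l (T m) n + r m (T n)) +
     T (l (T1 m) n + r m (T1 n) + (l1 (T m) n + r1 m (T n)))).
Proof.
move=> RB; split=> [E m n|E x y].
  move/(congr1 snd): (E (m, 0) (n, 0)); rewrite /ext_lin /= => {E}.
  rewrite !(linear0, linear0l, linear0r, addr0, add0r) [mu _ _ + _]addrC => ->.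
  by rewrite addrC !linearD /=; congr (_ + _); rewrite (AC (2*2) ((1*3)*(2*4))).
apply: ext_eq; rewrite /ext_lin /= ?RB //.
move: (E x.1 y.1); rewrite !(linearDl, linearDr, linearD) /= !RB.
rewrite !linearD /=.
move=> E1; rewrite (AC (3*3*1) (1*2*4*5*(6*3*7))) /= E1.
by rewrite (AC (4*(2*(2*2))) ((1*(3*7))*9*(2*8*4*10)*(5*6))).
Qed.

End DualExtension.

(** * Deformations and the linearized axioms *)

Section Deformation.
Variables (K : fieldType) (A M : lmodType K) (D : relRB A M).
Local Notation mu := (rb_mul D).
Local Notation l := (rb_l D).
Local Notation r := (rb_r D).
Local Notation T := (rb_T D).

(** The middle term of the proof: deformations and 2-cocycles are each compared with these
    equations. *)
Record linearized_relRB (q : quadruple A M) : Prop := LinearizedRelRB {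
  lin_mulA : forall a b c, q_mul q (mu a b) c + mu (q_mul q a b) c =
                           q_mul q a (mu b c) + mu a (q_mul q b c);
  lin_lA : forall a b m, q_l q (mu a b) m + l (q_mul q a b) m =
                         q_l q a (l b m) + l a (q_l q b m);
  lin_rA : forall m a b, q_r q (r m a) b + r (q_r q m a) b =
                         q_r q m (mu a b) + r m (q_mul q a b);
  lin_lr : forall a m b, q_r q (l a m) b + r (q_l q a m) b =
                         q_l q a (r m b) + l a (q_r q m b);
  lin_TE : forall m n,
    mu (q_T q m) (T n) + mu (T m) (q_T q n) + q_mul q (T m) (T n) =
    q_T q (l (T m) n + r m (T n)) +
    T (l (q_T q m) n + r m (q_T q n) + (q_l q (T m) n + q_r q m (T n)))
}.

Lemma determined_linearized (E : relRB (ext A) (ext M)) q :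
  determined_by D E q -> linearized_relRB q.
Proof.
case=> Emul El Er ET.
have muE := ext_bilP (fun a b => etrans (Emul a b) (tens1_t _ _)).
have lE := ext_bilP (fun a b => etrans (El a b) (tens1_t _ _)).
have rE := ext_bilP (fun a b => etrans (Er a b) (tens1_t _ _)).
have TE := ext_linP (fun a => etrans (ET a) (tens1_t _ _)).
split.
- apply/(ext_bilA _ _ _ _ (fun a b c => esym (rb_mulA D a b c))) => x y z.
  by rewrite -!muE rb_mulA.
- apply/(ext_bilA _ _ _ _ (rb_lA D)) => x y z.
  by rewrite -!lE -!muE rb_lA.
- apply/(ext_bilA _ _ _ _ (fun m a b => esym (rb_rA D m a b))) => x y z.
  by rewrite -!rE -!muE rb_rA.
- apply/(ext_bilA _ _ _ _ (rb_lr D)) => x y z.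
  by rewrite -!rE -!lE rb_lr.
apply/(ext_RB _ _ _ _ (rb_TE D)) => x y.
by rewrite -!TE -!muE -!lE -!rE rb_TE.
Qed.

Lemma linearized_deformation q : linearized_relRB q ->
  exists2 E : relRB (ext A) (ext M),
    infinitesimal_deformation D E & determined_by D E q.
Proof.
case=> mulA_ lA_ rA_ lr_ TE_.
pose E : relRB (ext A) (ext M) := @RelRB (dualnum K) (ext A) (ext M)
  (ext_bilinear mu (q_mul q)) (ext_bilinear l (q_l q)) (ext_bilinear r (q_r q))
  (ext_linear T (q_T q))
  (fun x y z => esym ((ext_bilA _ _ _ _
     (fun a b c => esym (rb_mulA D a b c))).2 mulA_ x y z))
  ((ext_bilA _ _ _ _ (rb_lA D)).2 lA_)
  (fun x y z => esym ((ext_bilA _ _ _ _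
     (fun m a b => esym (rb_rA D m a b))).2 rA_ x y z))
  ((ext_bilA _ _ _ _ (rb_lr D)).2 lr_)
  ((ext_RB _ _ _ _ (rb_TE D)).2 TE_).
(* The augmentation is the first projection, and first components of the extended maps are given by
   [D], so the morphism conditions hold by computation. *)
exists E; first by split.
by split=> *; rewrite !tens1_t !tens_1; apply: ext_eq;
  rewrite /= ?(linear0, linear0l, linear0r) ?add0r.
Qed.

Lemma deformation_determined (E : relRB (ext A) (ext M)) :
  infinitesimal_deformation D E -> exists q, determined_by D E q.
Proof.
case=> _ _ Emul El Er ET.
(* The witness collects the coefficients of [t]; the coefficients of 1 are those of [D] because the
   augmentation is a morphism. *)
exists (Quadruple (ext_snd_bil (rb_mul E)) (ext_snd_bil (rb_l E))
          (ext_snd_bil (rb_r E)) (ext_snd_lin (rb_T E))).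
split=> [a b|a m|m a|m]; rewrite tens1_t; apply: ext_eq => //=.
- by have := Emul (tens 1 a) (tens 1 b); rewrite !tens_1.
- by have := El (tens 1 a) (tens 1 m); rewrite !tens_1.
- by have := Er (tens 1 m) (tens 1 a); rewrite !tens_1.
- by have := ET (tens 1 m); rewrite !tens_1 /aug_tens /= => <-.
Qed.

End Deformation.

(** * Gerstenhaber brackets in low degree *)

Section Bracket.
Variables (K : fieldType) (V : lmodType K).

(** Each diamond of binary maps is a difference of two nestings, and the sign [(-1)^(1*1)] makes the
    bracket the sum of both diamonds. *)
Lemma bracket11 (f g : mmap V 1) (F G : V -> V -> V) v :
    (f =1 fun v => F (v ord0) (v ord_max)) ->
    (g =1 fun v => G (v ord0) (v ord_max)) ->
  bracket f g v =
    F (G (v ord0) (v (inord 1))) (v ord_max)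
    - F (v ord0) (G (v (inord 1)) (v ord_max))
    + (G (F (v ord0) (v (inord 1))) (v ord_max)
       - G (v ord0) (F (v (inord 1)) (v ord_max))).
Proof.
have i0 : inord 0 = ord0 :> 'I_3 by apply: val_inj; rewrite /= inordK.
have i2 : inord 2 = ord_max :> 'I_3 by apply: val_inj; rewrite /= inordK.
have diamondE (h k : mmap V 1) (H J : V -> V -> V) (w : {ffun 'I_3 -> V}) :
    (h =1 fun v => H (v ord0) (v ord_max)) ->
    (k =1 fun v => J (v ord0) (v ord_max)) ->
  diamond h k w = H (J (w ord0) (w (inord 1))) (w ord_max)
    - H (w ord0) (J (w (inord 1)) (w ord_max)).
  move=> hE kE; rewrite /diamond big_ord_recl big_ord1 !hE !ffunE /= !kE !ffunE.
  by rewrite /= !expr0 scale1r expr1 scaleN1r i0 i2.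
move=> fE gE; rewrite /bracket (diamondE _ _ _ _ _ fE gE).
rewrite (diamondE _ _ _ _ _ gE fE) !ffunE /= i0 i2 inordK //.
by rewrite expr1 scaleN1r opprK.
Qed.

(** All signs are trivial when one map is unary. The result is again a binary map, so the lemma
    iterates to [[[pi, T], T1]]. *)
Lemma bracket10 (f : mmap V 1) (g : mmap V 0) (F : V -> V -> V) (G : V -> V) :
    (f =1 fun v => F (v ord0) (v ord_max)) -> (g =1 fun v => G (v ord0)) ->
  bracket f g =1 fun v => F (G (v ord0)) (v ord_max) + F (v ord0) (G (v ord_max))
                          - G (F (v ord0) (v ord_max)).
Proof.
move=> fE gE v; rewrite /bracket /diamond big_ord_recl !big_ord1.
rewrite !muln0 !mul0n !expr0 !scale1r !fE !gE ?fE !ffunE /=.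
have i0 : inord 0 = ord0 :> 'I_2 by apply: val_inj; rewrite /= inordK.
have i1 : inord 1 = ord_max :> 'I_2 by apply: val_inj; rewrite /= inordK.
by rewrite ?ffunE /= ?addn0 ?add0n ?i0 ?i1 /= ?i0 ?i1.
Qed.

End Bracket.

(** * The differential of a quadruple and the cocycle condition *)

Section Cocycle.
Variables (K : fieldType) (A M : lmodType K).
Local Notation V := (A * M)%type.

Lemma ord2P (i : 'I_2) : i = ord0 \/ i = ord_max.
Proof. by case: i => [[|[|]]] // ?; [left|right]; apply: val_inj. Qed.

Lemma lift2_in_HomA (mu : {bilinear A -> A -> A}) (l : {bilinear A -> M -> M})
    (r : {bilinear M -> A -> M}) : in_HomA (lift2 mu l r).
Proof.
split=> [i v c x y upd|S v vS].
  rewrite /upd /lift2; have [->|->] := ord2P i; rewrite !ffunE /=;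
    congr pair; rewrite ?(linearDl, linearDr, linearZl_LR, linearZr_LR) //=;
    by rewrite scalerDr addrACA.
(* Counting the [M]-slots by membership bits lets the [match] compute once both bits are split. *)
have -> : #|S| = ((ord0 \in S) + (ord_max \in S))%N.
  rewrite -sum1_card big_mkcond big_ord_recl big_ord1.
  have -> : lift ord0 ord0 = ord_max :> 'I_2 by apply: val_inj.
  by do 2!case: (_ \in S).
move: (vS ord0) (vS ord_max); rewrite /lift2.
by case: (ord0 \in S); case: (ord_max \in S) => -> ->;
  rewrite ?(linear0l, linear0r, addr0).
Qed.

Lemma lift1_in_HomM (T : {linear M -> A}) : in_HomM (lift1 T).
Proof.
split=> [i v c x y upd|S v vS].
  rewrite /upd /lift1 (ord1 i) !ffunE /= linearP.
  by congr pair; rewrite /= scaler0 addr0.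
case: eqP => // SNT; rewrite /lift1.
have /negPf S0 : ord0 \notin S.
  by apply/negP => S0; apply: SNT; apply/setP => i; rewrite (ord1 i) S0 inE.
by have := vS ord0; rewrite S0 => ->; rewrite linear0.
Qed.

Variable D : relRB A M.
Local Notation mu := (rb_mul D).
Local Notation l := (rb_l D).
Local Notation r := (rb_r D).
Local Notation T := (rb_T D).

(** The terms of the bracket are grouped by argument type: AAA in the [A]-component; AAM, MAA and
    AMA in the [M]-component. *)
Lemma differential_fst q (v : {ffun 'I_3 -> V}) :
  let x := v ord0 in let y := v (inord 1) in let z := v ord_max in
  (differential D (quadruple_cochain q)).1 v =
  - ((q_mul q (mu x.1 y.1) z.1 + mu (q_mul q x.1 y.1) z.1
      - (q_mul q x.1 (mu y.1 z.1) + mu x.1 (q_mul q y.1 z.1)),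
      (q_l q (mu x.1 y.1) z.2 + l (q_mul q x.1 y.1) z.2
       - (q_l q x.1 (l y.1 z.2) + l x.1 (q_l q y.1 z.2)))
      + (q_r q (r x.2 y.1) z.1 + r (q_r q x.2 y.1) z.1
       - (q_r q x.2 (mu y.1 z.1) + r x.2 (q_mul q y.1 z.1)))
      + (q_r q (l x.1 y.2) z.1 + r (q_l q x.1 y.2) z.1
       - (q_l q x.1 (r y.2 z.1) + l x.1 (q_r q y.2 z.1)))) : V).
Proof.
move=> x y z; rewrite /= expr1 scaleN1r; congr (- _).
rewrite (bracket11 (F := fun x y : V => (mu x.1 y.1, l x.1 y.2 + r x.2 y.1))
  (G := fun x y : V => (q_mul q x.1 y.1, q_l q x.1 y.2 + q_r q x.2 y.1))) //.
congr pair => /=; rewrite -/x -/y -/z.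
  by rewrite (AC (2*2) (3*1*(4*2))) /= -opprD.
rewrite !(linearDl, linearDr) !opprD /=.
by rewrite [LHS](AC (((1*2)*3)*((1*2)*3))
  (((7*1)*(10*4))*((9*3)*(12*6))*((8*2)*(11*5)))).
Qed.

(** The bracket [[[pi, T], T1]] supplies the terms in [T1], and [Omega] those in [mu1], [l1], [r1];
    both signs are [(-1)^2]. *)
Lemma differential_snd q (v : {ffun 'I_2 -> V}) :
  let m := (v ord0).2 in let n := (v ord_max).2 in
  (differential D (quadruple_cochain q)).2 v =
  (mu (q_T q m) (T n) + mu (T m) (q_T q n) + q_mul q (T m) (T n)
   - (q_T q (l (T m) n + r m (T n)) +
      T (l (q_T q m) n + r m (q_T q n) + (q_l q (T m) n + q_r q m (T n)))), 0).
Proof.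
move=> m n; rewrite /= expr2 mulN1r opprK scale1r.
pose F (x y : V) : V := (mu x.1 y.1, l x.1 y.2 + r x.2 y.1).
pose S (x : V) : V := (T x.2, 0).
have FE : pi_map D =1 fun v => F (v ord0) (v ord_max) by [].
have SE : T_map D =1 fun v => S (v ord0) by [].
rewrite (bracket10 (F := fun x y => F (S x) y + F x (S y) - S (F x y))
  (G := fun x : V => (q_T q x.2, 0)) (bracket10 FE SE)) //.
rewrite /Omega expr2 mulN1r opprK scale1r big_ord_recl big_ord1.
rewrite /lift2 !ffunE /= /F /S /= -/m -/n.
rewrite !(linear0, linear0l, linear0r).
congr pair; rewrite /= ?(subr0, addr0) ?add0r //.
rewrite !linearD /=.
by rewrite [LHS](AC (2*2*2*(1*2)) ((1*3*7)*((5*6)*((2*4)*(9*8))))).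
Qed.

Lemma cocycleP q :
  cocycle D (quadruple_cochain q) <-> linearized_relRB D q.
Proof.
split=> [[_ [dq1 dq2]]|[mulA lA rA lr TE]]; last first.
  split; first by split; [apply: lift2_in_HomA | apply: lift1_in_HomM].
  split=> v; rewrite ?differential_fst ?differential_snd.
    by rewrite mulA lA rA lr !subrr !addr0 oppr0.
  by rewrite TE subrr.
(* Homogeneous arguments isolate one axiom each: an entry from [M] in a chosen slot kills the other
   two defects of the [M]-component. *)
have E1 (x y z : V) := dq1 [ffun i : 'I_3 => nth 0 [:: x; y; z] i].
have E2 (x y : V) := dq2 [ffun i : 'I_2 => nth 0 [:: x; y] i].
split=> [a b c|a b m|m a b|a m b|m n]; apply/eqP; rewrite -subr_eq0; apply/eqP.
- move/eqP: (E1 (a, 0) (b, 0) (c, 0)); rewrite differential_fst oppr_eq0.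
  by rewrite !ffunE /= inordK // => /eqP/(congr1 fst).
- move/eqP: (E1 (a, 0) (b, 0) (0, m)); rewrite differential_fst oppr_eq0.
  rewrite !ffunE /= inordK // => /eqP/(congr1 snd) /=.
  by rewrite !(linear0l, linear0r, subr0, addr0).
- move/eqP: (E1 (0, m) (a, 0) (b, 0)); rewrite differential_fst oppr_eq0.
  rewrite !ffunE /= inordK // => /eqP/(congr1 snd) /=.
  by rewrite !(linear0l, linear0r, subr0, oppr0, addr0, add0r).
- move/eqP: (E1 (a, 0) (0, m) (b, 0)); rewrite differential_fst oppr_eq0.
  rewrite !ffunE /= inordK // => /eqP/(congr1 snd) /=.
  by rewrite !(linear0l, linear0r, subr0, oppr0, addr0, add0r).
- move: (E2 (0, m) (0, n)); rewrite differential_snd.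
  by rewrite !ffunE /= => /(congr1 fst).
Qed.

End Cocycle.

Theorem theorem5p3 (K : fieldType) (charK : [pchar K]%R =i pred0)
    (A M : lmodType K) (D : relRB A M) :
  [/\ forall (E : relRB (ext A) (ext M)) (q : quadruple A M),
        infinitesimal_deformation D E -> determined_by D E q ->
        cocycle D (quadruple_cochain q),
      forall E : relRB (ext A) (ext M), infinitesimal_deformation D E ->
        exists2 q : quadruple A M,
          cocycle D (quadruple_cochain q) & determined_by D E q
    & forall q : quadruple A M, cocycle D (quadruple_cochain q) ->
        exists2 E : relRB (ext A) (ext M),
          infinitesimal_deformation D E & determined_by D E q].
Proof.
split=> [E q _ Eq|E /deformation_determined[q Eq]|q /cocycleP].
- exact/cocycleP/(determined_linearized Eq).
- by exists q => //; apply/cocycleP/(determined_linearized Eq).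
- exact: linearized_deformation.
Qed.
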